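(* Let $f,l:\mathbb R\to\mathbb C$ be the infinitely differentiable complex-valued functions $$f(x)=\frac{\alpha^x-\beta^x}{\alpha-\beta},\qquad l(x)=\alpha^x+\beta^x .$$ Then for every $j\in\mathbb Z$: $f(j)=F_j$ and $l(j)=L_j$; $$\Re\big(f'(j)\big)=\frac{L_j}{\sqrt5}\ln\alpha,\qquad \Re\big(l'(j)\big)=F_j\sqrt5\,\ln\alpha;$$ $$\Im\big(f'(j)\big)=-\frac{\pi\beta^j}{\sqrt5},\qquad \Im\big(l'(j)\big)=\pi\beta^j .$$
   Context: $\alpha=(1+\sqrt5)/2$, $\beta=(1-\sqrt5)/2<0$. For real $x$, $\beta^x$ is taken with the principal value, $\beta^x=(-\beta)^x e^{i\pi x}$. For $n\in\mathbb Z$ the Fibonacci and Lucas numbers are $F_n,L_n$ satisfying $F_n=F_{n-1}+F_{n-2}$, $F_0=0$, $F_1=1$ and $L_n=L_{n-1}+L_{n-2}$, $L_0=2$, $L_1=1$, extended to negative indices by $F_{-n}=(-1)^{n-1}F_n$, $L_{-n}=(-1)^nL_n$. *)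

(* Defs.v *)
From Stdlib Require Import Reals ZArith.
From Coquelicot Require Import Coquelicot.

Fixpoint fib_nat (n : nat) : Z :=
  match n with
  | O => 0%Z
  | S m => match m with O => 1%Z | S k => (fib_nat m + fib_nat k)%Z end
  end.

Fixpoint luc_nat (n : nat) : Z :=
  match n with
  | O => 2%Z
  | S m => match m with O => 1%Z | S k => (luc_nat m + luc_nat k)%Z end
  end.

Definition fib (n : Z) : Z :=
  match n with
  | Z0 => fib_nat 0
  | Zpos p => fib_nat (Pos.to_nat p)
  | Zneg p => ((-1) ^ (Zpos p - 1) * fib_nat (Pos.to_nat p))%Z
  end.

Definition luc (n : Z) : Z :=
  match n with
  | Z0 => luc_nat 0
  | Zpos p => luc_nat (Pos.to_nat p)
  | Zneg p => ((-1) ^ Zpos p * luc_nat (Pos.to_nat p))%Z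
  end.

Open Scope R_scope.

Definition alpha : R := (1 + sqrt 5) / 2.
Definition beta : R := (1 - sqrt 5) / 2.

Definition Cexp (z : C) : C := (exp (Re z) * cos (Im z), exp (Re z) * sin (Im z)).

(* The principal value (-beta)^x e^(i pi x); note that -beta > 0, whereas
   Rpower beta x would be meaningless. *)
Definition beta_pow (x : R) : C :=
  (RtoC (Rpower (- beta) x) * Cexp (Ci * RtoC (PI * x)))%C.

Definition fibR (x : R) : C :=
  ((RtoC (Rpower alpha x) - beta_pow x) / RtoC (alpha - beta))%C.

Definition lucR (x : R) : C :=
  (RtoC (Rpower alpha x) + beta_pow x)%C.

(* Derivative of a function of a real variable, C being regarded as a normed
   space over R (not the holomorphic derivative). *)
Definition is_deriveRC (g : R -> C) (x : R) (d : C) : Prop :=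
  @is_derive R_AbsRing C_R_NormedModule g x d.

Definition smooth (g : R -> C) : Prop :=
  exists D : nat -> R -> C,
    (forall x, D 0%nat x = g x) /\
    (forall n x, is_deriveRC (D n) x (D (S n) x)).

(* Main.v *)
Require Import Defs.
From Stdlib Require Import Reals ZArith Lra Lia.
From Coquelicot Require Import Coquelicot.
Open Scope R_scope.

(** Both functions are combinations [a e^(u x) + b e^(w x)] with [u = ln alpha]
    and [w = - ln alpha + i pi], because [-beta = 1 / alpha].  Differentiation
    multiplies [a] by [u] and [b] by [w]; at an integer [j] the two exponentials
    are the real numbers [alpha^j] and [beta^j], so the real and imaginary parts
    of the derivative come from those of [w], together with Binet's formulas. *)

(** The pair is the real-linear combination of the fixed vectors 1 and i with coefficient functions
    [u] and [v], so the sum and scalar rules over R suffice. *)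
Lemma is_deriveRC_pair (u v : R -> R) (x du dv : R) :
  is_derive u x du -> is_derive v x dv ->
  is_deriveRC (fun t => (u t, v t)) x (du, dv).
Proof.
  intros Hu Hv.
  assert (H := @is_derive_plus R_AbsRing C_R_NormedModule _ _ _ _ _
    (@is_derive_scal_l R_AbsRing C_R_NormedModule u x du (1, 0) Hu)
    (@is_derive_scal_l R_AbsRing C_R_NormedModule v x dv (0, 1) Hv)).
  unfold is_deriveRC.
  replace ((du, dv) : C) with
    (@plus C_R_NormedModule (@scal R_AbsRing C_R_NormedModule du (1, 0))
                            (@scal R_AbsRing C_R_NormedModule dv (0, 1))).
  - refine (is_derive_ext _ _ _ _ _ H).
    intros t; apply injective_projections; simpl;
      unfold plus, scal; simpl; unfold mult; simpl; ring.
  - apply injective_projections; simpl;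
      unfold plus, scal; simpl; unfold mult; simpl; ring.
Qed.

Lemma is_deriveRC_Cexp (c w : C) (x : R) :
  is_deriveRC (fun t => c * Cexp (w * RtoC t))%C x
              (c * w * Cexp (w * RtoC x))%C.
Proof.
  destruct c as [c1 c2], w as [p q].
  unfold Cexp, Cmult, RtoC, Re, Im; simpl.
  apply is_deriveRC_pair; auto_derive; trivial; unfold Rminus; ring.
Qed.

Definition exp_comb (u w a b : C) (x : R) : C :=
  (a * Cexp (u * RtoC x) + b * Cexp (w * RtoC x))%C.

Lemma is_deriveRC_exp_comb (u w a b : C) (x : R) :
  is_deriveRC (exp_comb u w a b) x (exp_comb u w (a * u) (b * w) x).
Proof.
  exact (@is_derive_plus R_AbsRing C_R_NormedModule _ _ _ _ _
    (is_deriveRC_Cexp a u x) (is_deriveRC_Cexp b w x)).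
Qed.

Lemma smooth_exp_comb (u w a b : C) : smooth (exp_comb u w a b).
Proof.
  (* Each of the n differentiations contributes one factor [u] and one factor [w] to the
     coefficients. *)
  exists (fun n => exp_comb u w (a * Cpow u n) (b * Cpow w n)); split.
  - intros x; unfold exp_comb; simpl; ring.
  - intros n x; simpl.
    replace (a * (u * Cpow u n))%C with (a * Cpow u n * u)%C by ring.
    replace (b * (w * Cpow w n))%C with (b * Cpow w n * w)%C by ring.
    apply is_deriveRC_exp_comb.
Qed.

Lemma smooth_ext (g h : R -> C) : (forall x, g x = h x) -> smooth g -> smooth h.
Proof.
  intros E (D & H0 & HS); exists D; split; [|exact HS].
  intros x; rewrite H0; apply E.
Qed.

Lemma sqrt5_pos : 0 < sqrt 5.
Proof. apply sqrt_lt_R0; lra. Qed.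

Lemma sqrt5_sqr : sqrt 5 * sqrt 5 = 5.
Proof. apply sqrt_sqrt; lra. Qed.

Lemma alpha_pos : 0 < alpha.
Proof. unfold alpha; pose proof sqrt5_pos; lra. Qed.

Lemma alpha_mul_beta : alpha * beta = -1.
Proof. unfold alpha, beta; pose proof sqrt5_sqr; lra. Qed.

Lemma beta_neg : beta < 0.
Proof. pose proof alpha_pos; pose proof alpha_mul_beta; nra. Qed.

Lemma alpha_sub_beta : alpha - beta = sqrt 5.
Proof. unfold alpha, beta; field. Qed.

Lemma ln_opp_beta : ln (- beta) = - ln alpha.
Proof.
  pose proof alpha_pos; pose proof alpha_mul_beta.
  rewrite <- ln_Rinv by trivial; f_equal.
  apply (Rmult_eq_reg_l alpha); [rewrite Rinv_r|]; lra.
Qed.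

Definition alpha_exponent : C := RtoC (ln alpha).
(** This is the principal logarithm of [beta], since ln(-beta) = -ln alpha. *)
Definition beta_exponent : C := (- ln alpha, PI).

Lemma Cexp_alpha (x : R) : Cexp (alpha_exponent * RtoC x) = RtoC (Rpower alpha x).
Proof.
  unfold Cexp, alpha_exponent, Cmult, RtoC, Rpower; simpl.
  replace (ln alpha * 0 + 0 * x) with 0 by ring.
  rewrite cos_0, sin_0; f_equal; [|ring].
  rewrite Rmult_1_r; f_equal; ring.
Qed.

Lemma Cexp_beta (x : R) : Cexp (beta_exponent * RtoC x) = beta_pow x.
Proof.
  unfold beta_pow, Cexp, beta_exponent, Cmult, RtoC, Ci, Rpower; simpl.
  rewrite ln_opp_beta.
  replace (0 * (PI * x) - 1 * 0) with 0 by ring.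
  replace (0 * 0 + 1 * (PI * x)) with (PI * x) by ring.
  replace (- ln alpha * 0 + PI * x) with (PI * x) by ring.
  replace (- ln alpha * x - PI * 0) with (x * - ln alpha) by ring.
  rewrite exp_0; f_equal; ring.
Qed.

Lemma fibR_exp_comb (x : R) :
  exp_comb alpha_exponent beta_exponent (RtoC (/ sqrt 5)) (RtoC (- / sqrt 5)) x
  = fibR x.
Proof.
  pose proof sqrt5_pos.
  unfold exp_comb, fibR, Cdiv; rewrite Cexp_alpha, Cexp_beta, alpha_sub_beta.
  rewrite RtoC_opp, RtoC_inv by lra; ring.
Qed.

Lemma lucR_exp_comb (x : R) :
  exp_comb alpha_exponent beta_exponent (RtoC 1) (RtoC 1) x = lucR x.
Proof. unfold exp_comb, lucR; rewrite Cexp_alpha, Cexp_beta; ring. Qed.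

Lemma cos_sin_PI_IZR (j : Z) :
  cos (PI * IZR j) = powerRZ (-1) j /\ sin (PI * IZR j) = 0.
Proof.
  revert j; apply Z.bi_induction.
  - intros ? ? ->; reflexivity.
  - rewrite Rmult_0_r, cos_0, sin_0; auto.
  (* A shift by pi negates both cosine and sine, and also (-1)^j; the step is therefore an
     equivalence, which carries the induction to negative integers too. *)
  - intros j; unfold Z.succ; rewrite plus_IZR, powerRZ_add by lra.
    rewrite Rmult_plus_distr_l, Rmult_1_r, neg_cos, neg_sin.
    simpl powerRZ; split; intros [? ?]; split; lra.
Qed.

Lemma beta_pow_IZR (j : Z) : beta_pow (IZR j) = RtoC (powerRZ beta j).
Proof.
  destruct (cos_sin_PI_IZR j) as [Hc Hs].
  (* The sign is split off because [Rpower] agrees with integer powers only for a positive base,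
     here -beta; the factor (-1)^j is e^(i pi j). *)
  replace (powerRZ beta j) with (powerRZ (- beta) j * powerRZ (-1) j)
    by (rewrite <- powerRZ_mult; f_equal; ring).
  rewrite powerRZ_Rpower by (pose proof beta_neg; lra).
  unfold beta_pow, Cexp, Cmult, RtoC, Ci; simpl.
  replace (0 * (PI * IZR j) - 1 * 0) with 0 by ring.
  replace (0 * 0 + 1 * (PI * IZR j)) with (PI * IZR j) by ring.
  rewrite exp_0, Hc, Hs; f_equal; ring.
Qed.

Lemma exp_comb_IZR (a b : C) (j : Z) :
  exp_comb alpha_exponent beta_exponent a b (IZR j)
  = (a * RtoC (powerRZ alpha j) + b * RtoC (powerRZ beta j))%C.
Proof.
  unfold exp_comb; rewrite Cexp_alpha, Cexp_beta, beta_pow_IZR.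
  rewrite (powerRZ_Rpower alpha) by exact alpha_pos; reflexivity.
Qed.

(** Two consecutive indices are carried along because the recurrence has order two; [alpha] and
    [beta] both solve t^2 = t + 1, so their powers obey it. *)
Lemma binet_nat (n : nat) :
  (alpha ^ n - beta ^ n = sqrt 5 * IZR (fib_nat n) /\
   alpha ^ n + beta ^ n = IZR (luc_nat n)) /\
  (alpha ^ S n - beta ^ S n = sqrt 5 * IZR (fib_nat (S n)) /\
   alpha ^ S n + beta ^ S n = IZR (luc_nat (S n))).
Proof.
  induction n as [|n [[Hf Hl] [Hf' Hl']]].
  - simpl; unfold alpha, beta; lra.
  - split; [split; assumption|].
    change (fib_nat (S (S n))) with (fib_nat (S n) + fib_nat n)%Z.
    change (luc_nat (S (S n))) with (luc_nat (S n) + luc_nat n)%Z.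
    rewrite !plus_IZR.
    assert (Ha : alpha ^ S (S n) = alpha ^ S n + alpha ^ n).
    { replace (alpha ^ S (S n)) with (alpha * alpha * alpha ^ n) by (simpl; ring).
      replace (alpha * alpha) with (alpha + 1)
        by (unfold alpha; pose proof sqrt5_sqr; lra).
      simpl; ring. }
    assert (Hb : beta ^ S (S n) = beta ^ S n + beta ^ n).
    { replace (beta ^ S (S n)) with (beta * beta * beta ^ n) by (simpl; ring).
      replace (beta * beta) with (beta + 1)
        by (unfold beta; pose proof sqrt5_sqr; lra).
      simpl; ring. }
    rewrite Ha, Hb; split; lra.
Qed.

(** Here 1/a = -b. This carries Binet's formulas to negative indices, where inversion exchanges
    [alpha] and [beta] up to sign. *)
Lemma pow_inv_of_mul_eq_opp1 (a b : R) (n : nat) :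
  a * b = -1 -> / a ^ n = (-1) ^ n * b ^ n.
Proof.
  intros H.
  assert (a <> 0) by (intros ->; lra).
  rewrite <- Rpow_mult_distr, <- pow_inv; f_equal.
  apply (Rmult_eq_reg_l a); [rewrite Rinv_r|]; lra.
Qed.

Lemma binet (j : Z) :
  powerRZ alpha j - powerRZ beta j = sqrt 5 * IZR (fib j) /\
  powerRZ alpha j + powerRZ beta j = IZR (luc j).
Proof.
  destruct j as [|p|p].
  - simpl; lra.
  - exact (proj1 (binet_nat (Pos.to_nat p))).
  - destruct (proj1 (binet_nat (Pos.to_nat p))) as [Hf Hl].
    simpl powerRZ; unfold fib, luc.
    rewrite (pow_inv_of_mul_eq_opp1 alpha beta) by exact alpha_mul_beta.
    rewrite (pow_inv_of_mul_eq_opp1 beta alpha)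
      by (rewrite Rmult_comm; exact alpha_mul_beta).
    rewrite !mult_IZR, <- Hl.
    assert (Hs : IZR ((-1) ^ Z.pos p) = (-1) ^ Pos.to_nat p)
      by (rewrite pow_IZR, positive_nat_Z; reflexivity).
    (* Exchanging [alpha] and [beta] negates their difference but not their sum, hence the exponent
       p - 1 in [fib] against p in [luc]. The successor rule for powers applies since p - 1 is
       nonnegative. *)
    assert (Hs' : IZR ((-1) ^ Z.pos p) = - IZR ((-1) ^ (Z.pos p - 1))).
    { replace (Z.pos p) with (Z.succ (Z.pos p - 1)) at 1 by lia.
      rewrite Z.pow_succ_r, mult_IZR by lia; lra. }
    split.
    + transitivity (- IZR ((-1) ^ Z.pos p) * (sqrt 5 * IZR (fib_nat (Pos.to_nat p)))).
      * rewrite <- Hf, Hs; ring.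
      * rewrite Hs'; ring.
    + rewrite Hs; ring.
Qed.

Theorem lemma2 :
  smooth fibR /\ smooth lucR /\
  exists f' l' : R -> C,
    (forall x : R, is_deriveRC fibR x (f' x)) /\
    (forall x : R, is_deriveRC lucR x (l' x)) /\
    forall j : Z,
      fibR (IZR j) = RtoC (IZR (fib j)) /\
      lucR (IZR j) = RtoC (IZR (luc j)) /\
      Re (f' (IZR j)) = IZR (luc j) / sqrt 5 * ln alpha /\
      Re (l' (IZR j)) = IZR (fib j) * sqrt 5 * ln alpha /\
      Im (f' (IZR j)) = - (PI * powerRZ beta j / sqrt 5) /\
      Im (l' (IZR j)) = PI * powerRZ beta j.
Proof.
  split; [|split].
  - exact (smooth_ext _ _ fibR_exp_comb (smooth_exp_comb _ _ _ _)).
  - exact (smooth_ext _ _ lucR_exp_comb (smooth_exp_comb _ _ _ _)).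
  (* The derivatives are left open and found by unification with [is_deriveRC_exp_comb]. *)
  - eexists; eexists; split; [|split].
    + intros x; exact (is_derive_ext _ _ _ _ fibR_exp_comb
                         (is_deriveRC_exp_comb _ _ _ _ x)).
    + intros x; exact (is_derive_ext _ _ _ _ lucR_exp_comb
                         (is_deriveRC_exp_comb _ _ _ _ x)).
    + intros j; pose proof sqrt5_pos as H5; destruct (binet j) as [Hf Hl].
      (* Everything is reduced to alpha^j and beta^j. The real part -ln alpha of [beta_exponent]
         flips the sign of the beta^j term, which swaps Fibonacci and Lucas numbers; its imaginary
         part pi is the only source of imaginary terms. *)
      rewrite <- fibR_exp_comb, <- lucR_exp_comb, !exp_comb_IZR, <- Hl.
      replace (IZR (fib j)) with ((powerRZ alpha j - powerRZ beta j) / sqrt 5)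
        by (rewrite Hf; field; lra).
      unfold alpha_exponent, beta_exponent, Cmult, Cplus, RtoC, Re, Im; simpl.
      repeat split; try (apply injective_projections; simpl); field; lra.
Qed.
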